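(* Let $r$ and $s$ be positive integers with $r \geq s \geq 3$ and $\gcd(r,s)=1$. If $r \leq 2s - 2$, then $f(s,r,\mathbb{Z}) = 6s - 4$.
   Context: For integers $a\le b$, $[a,b]=\{n\in\mathbb{N} : a\le n\le b\}$. For a finite set $X\subseteq\mathbb{N}$, $\mathrm{diam}(X)=\max(X)-\min(X)$. Given a coloring $\Delta:[1,n]\to\mathbb{Z}$, a subset $Y$ is zero-sum mod $m$ if $\sum_{y\in Y}\Delta(y)\equiv 0 \pmod m$. $f(s,r,\mathbb{Z})$ denotes the smallest positive integer $n$ such that for every coloring $\Delta:[1,n]\to\mathbb{Z}$ there exist subsets $S_1,S_2\subseteq[1,n]$ with: (a) $S_1$ zero-sum mod $s$ and $S_2$ zero-sum mod $r$; (b) $|S_1|=s$, $|S_2|=r$; (c) $\max(S_1)<\min(S_2)$; (d) $\mathrm{diam}(S_1)\le\mathrm{diam}(S_2)$. *)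

(* Defs.v *)
From mathcomp Require Import all_boot all_order all_algebra finmap.
From mathcomp Require Import boolp classical_sets.

Set Implicit Arguments.
Unset Strict Implicit.
Unset Printing Implicit Defensive.

Definition nat_itv (a b : nat) : {fset nat} :=
  [fset n in index_iota a b.+1]%fset.

Definition fset_max (X : {fset nat}) : nat := \max_(x <- X) x.

(* The neutral value [fset_max X] bounds every element of X, so this is the
   minimum of X whenever X is nonempty. *)
Definition fset_min (X : {fset nat}) : nat :=
  \big[minn/fset_max X]_(x <- X) x.

Definition diam (X : {fset nat}) : nat := fset_max X - fset_min X.

Definition zero_sum_mod (m : nat) (Delta : nat -> int) (Y : {fset nat}) : Prop :=
  (\sum_(y <- Y) Delta y = 0 %[mod m])%Z.

(* A coloring of [1, n] is given by a total function on nat; only its values on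
   [1, n] matter, since S1 and S2 are subsets of [1, n]. *)
Definition forces_pair (s r n : nat) : Prop :=
  forall Delta : nat -> int, exists S1 S2 : {fset nat},
    [/\ (S1 `<=` nat_itv 1 n)%fset /\ (S2 `<=` nat_itv 1 n)%fset,
        zero_sum_mod s Delta S1 /\ zero_sum_mod r Delta S2,
        #|` S1 |%fset = s /\ #|` S2 |%fset = r,
        fset_max S1 < fset_min S2 &
        diam S1 <= diam S2].

Definition smallest_positive (P : nat -> Prop) (n : nat) : Prop :=
  [/\ 0 < n, P n & forall k, 0 < k -> P k -> n <= k].

(* f(s, r, Z); the default value 0 is taken only if no positive n is forcing. *)
Definition fZ (s r : nat) : nat :=
  xget 0 [set n | smallest_positive (forces_pair s r) n]%classic.

Lemma in_nat_itv a b n : (n \in nat_itv a b) = (a <= n <= b).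
Proof. by rewrite in_fset /= mem_index_iota ltnS. Qed.

Lemma fset_max_ge (X : {fset nat}) x : x \in X -> x <= fset_max X.
Proof. by move=> xX; rewrite /fset_max (big_rem x) //= leq_maxl. Qed.

Lemma fset_max_in (X : {fset nat}) x : x \in X -> fset_max X \in X.
Proof.
have max_mem (l : seq nat) y : y \in l -> \max_(z <- l) z \in l.
  elim: l y => // a l IH y _; rewrite big_cons.
  case: l IH => [|b l] IH; first by rewrite big_nil maxn0 mem_head.
  rewrite /maxn; case: ifP => _; last exact: mem_head.
  by rewrite in_cons (IH b) ?mem_head ?orbT.
exact: max_mem.
Qed.

Lemma fset_min_le (X : {fset nat}) x : x \in X -> fset_min X <= x.
Proof.
have min_le (l : seq nat) m y : y \in l -> \big[minn/m]_(z <- l) z <= y.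
  elim: l => // a l IH; rewrite in_cons big_cons geq_min.
  by case/predU1P => [->|/IH ->]; rewrite ?leqnn ?orbT.
exact: min_le.
Qed.

Lemma fset_min_in (X : {fset nat}) x : x \in X -> fset_min X \in X.
Proof.
move=> /fset_max_in maxX; rewrite /fset_min big_seq.
by elim/big_ind: _ => // a b aX bX; rewrite /minn; case: ifP.
Qed.

(* Main.v *)
(**
Lower bound: by the Chinese remainder theorem the colorings mod s and mod r can
be prescribed independently. Color mod s by blocks of length s - 1 of alternating
colors 0, 1; then every zero-sum s-set is monochromatic and has diameter at least
2s - 2. Hence S2 lies in [2s, 6s - 5], which mod r is split into two monochromatic
halves of length 2s - 2, so that the diameter of S2 is at most 2s - 3.

Upper bound: the Erdos-Ginzburg-Ziv theorem (EGZ) gives S1 in [1, 2s - 1], of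
diameter at most 2s - 2. Among the 4s - 3 remaining points, take the first r - 1,
the middle one and the last r - 1; EGZ gives S2 there, and any r of these 2r - 1
points have diameter at least 2s - 2.

EGZ for a prime p: sort the residues and pair the i-th with the (i + p - 1)-th.
If some pair is equal, p consecutive residues are equal; otherwise the sums that
choose one element in each of the p - 1 pairs cover Z/p. Composite moduli follow
by induction.
*)
Require Import Defs.
From mathcomp Require Import all_boot all_algebra finmap zify.

Set Implicit Arguments.
Unset Strict Implicit.
Unset Printing Implicit Defensive.
Import GRing.Theory.

(** * Erdos-Ginzburg-Ziv for a prime modulus *)

(** A two-point case of Cauchy-Davenport: if translation by [d] keeps [A] inside itself, [A] is
    everything because [d] generates ['F_p]; otherwise the union gains a point. *)
Lemma card_addset_Fp (p : nat) (A : {set 'F_p}) (d : 'F_p) :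
  prime p -> d != 0%R -> A != set0 ->
  minn p #|A|.+1 <= #|A :|: [set (x + d)%R | x in A]|.
Proof.
move=> pp d0 /set0Pn [a aA]; set B := imset _ _.
have cB : #|B| = #|A| by rewrite card_imset //; exact: addIr.
have [sBA | nsBA] := boolP (B \subset A); last first.
  rewrite geq_min; apply/orP; right; apply: proper_card.
  rewrite properE subsetUl /=; apply: contra nsBA.
  exact: subset_trans (subsetUr _ _).
have stepA x : x \in A -> (x + d)%R \in A.
  by move=> xA; apply: (subsetP sBA); apply: imset_f.
have iterA n : (a + d *+ n)%R \in A.
  by elim: n => [|n IHn]; rewrite ?mulr0n ?addr0 // mulrSr addrA stepA.
suff -> : A = [set: 'F_p] by rewrite setTU cardsT card_Fp // geq_minl.
apply/setP => x; rewrite inE; have := iterA (val ((x - a) / d)%R).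
by rewrite -mulr_natr natr_Zp mulrCA mulfV // mulr1 addrC subrK.
Qed.

(** Each pair with distinct values enlarges the set of reachable sums, by [card_addset_Fp]. The list
    [c] holds the chosen entries, [d] the rejected ones. *)
Lemma transversal_sums (T : eqType) (p : nat) (f : T -> 'F_p) (z : seq (T * T)) :
  prime p -> all (fun xy => f xy.1 != f xy.2) z ->
  exists2 A : {set 'F_p}, minn p (size z).+1 <= #|A| &
    forall v, v \in A -> exists c d : seq T,
      [/\ perm_eq (c ++ d) (unzip1 z ++ unzip2 z), size c = size z &
          (\sum_(x <- c) f x)%R = v].
Proof.
move=> pp; elim: z => [|[x y] z IHz] /=.
  move=> _; exists [set 0%R]; first by rewrite cards1 geq_minr.
  by move=> v /set1P ->; exists [::], [::]; rewrite big_nil.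
case/andP => fxy /IHz [A cA reachA].
have A0 : A != set0.
  rewrite -card_gt0; apply: leq_trans cA; rewrite leq_min prime_gt0 //.
have d0 : (f y - f x)%R != 0%R by rewrite subr_eq0 eq_sym.
pose A' := [set (u + f x)%R | u in A].
have A'0 : A' != set0.
  by rewrite -card_gt0 card_imset ?card_gt0 //; exact: addIr.
exists (A' :|: [set (u + (f y - f x))%R | u in A']).
  apply: leq_trans (card_addset_Fp pp d0 A'0).
  rewrite card_imset; last exact: addIr.
  by move: #|_| cA => n; lia.
have perm_swap (c d : seq T) u w : perm_eq (c ++ d) (unzip1 z ++ unzip2 z) ->
    (u, w) = (x, y) \/ (u, w) = (y, x) ->
    perm_eq ((u :: c) ++ w :: d) ((x :: unzip1 z) ++ y :: unzip2 z).
  move=> /permP pcd uw; apply/permP => a; have := pcd a.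
  by case: uw => [[-> ->]|[-> ->]]; rewrite /= !count_cat /=; lia.
move=> v /setUP [/imsetP [u uA ->] | /imsetP [_ /imsetP [u uA ->] ->]];
  have [c [d [pcd sc sumc]]] := reachA _ uA.
- exists (x :: c), (y :: d); rewrite /= sc big_cons sumc addrC.
  by split=> //; apply: perm_swap pcd _; left.
- exists (y :: c), (x :: d); rewrite /= sc big_cons sumc.
  split=> //; first by apply: perm_swap pcd _; right.
  by rewrite addrA (addrAC u) addrK addrC.
Qed.

Definition has_zero_sum_sub (T : eqType) (m : nat) (f : T -> int) (l : seq T) : Prop :=
  exists l1 l2 : seq T,
    [/\ perm_eq (l1 ++ l2) l, size l1 = m & (m %| (\sum_(x <- l1) f x)%R)%Z].

Lemma EGZ_prime (T : eqType) (p : nat) (f : T -> int) (l : seq T) :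
  prime p -> 2 * p - 1 <= size l -> has_zero_sum_sub p f l.
Proof.
move=> pp sz_l; have p_gt1 := prime_gt1 pp.
pose g x : 'F_p := ((f x)%:~R)%R.
have zero_sumE (l1 : seq T) :
    (\sum_(x <- l1) g x = 0)%R -> (p %| (\sum_(x <- l1) f x)%R)%Z.
  by move=> g0; rewrite (dvdz_pcharf (pchar_Fp pp)) rmorph_sum /= -/g g0.
pose leg := relpre (fun x => g x : nat) leq.
pose s := sort leg l.
have leg_refl : reflexive leg by move=> x; exact: leqnn.
have leg_tr : transitive leg by move=> x y z; exact: leq_trans.
have s_sorted : sorted leg s by apply: sort_sorted => x y; exact: leq_total.
have sz_s : 2 * p - 1 <= size s by rewrite size_sort.
have perm_s : perm_eq s l by rewrite perm_sort.
have [x0 _] : exists x0 : T, true.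
  by move: sz_l; case: (l) => [|x0 l' _]; [rewrite /=; lia | exists x0].
pose a := take p.-1 s; pose b := take p.-1 (drop p.-1 s).
have sz_a : size a = p.-1 by rewrite size_takel //; lia.
have sz_b : size b = p.-1 by rewrite size_takel // size_drop; lia.
have [alln | /allPn [xy /(nthP (x0, x0)) [i]]] :=
    boolP (all (fun xy => g xy.1 != g xy.2) (zip a b)).
  have [A cA reachA] := transversal_sums pp alln.
  rewrite size_zip sz_a sz_b minnn prednK ?minnn in cA; last by lia.
  have AT v : v \in A.
    suff -> : A = [set: 'F_p] by rewrite inE.
    by apply/eqP; rewrite eqEcard subsetT cardsT card_Fp.
  have : 0 < size (drop p.-1 (drop p.-1 s)) by rewrite !size_drop; lia.
  case defr: (drop _ (drop _ _)) => [|e t] // _.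
  have defs : s = a ++ b ++ e :: t by rewrite -defr !cat_take_drop.
  (* The choices are made to sum to [- g e], so that the unpaired entry [e] completes [p] terms of
     sum zero. *)
  have [c [d [pcd sc sumc]]] := reachA _ (AT (- g e)%R).
  exists (e :: c), (d ++ t); split.
  - apply: perm_trans perm_s; rewrite defs; apply/permP => q.
    have := permP pcd q; rewrite unzip1_zip ?unzip2_zip ?sz_a ?sz_b //.
    by rewrite /= !count_cat /=; lia.
  - by rewrite /= sc size_zip sz_a sz_b minnn prednK //; lia.
  - by apply: zero_sumE; rewrite big_cons sumc subrr.
rewrite size_zip sz_a sz_b minnn => lt_i defxy; rewrite -{}defxy.
rewrite nth_zip ?sz_a ?sz_b //= negbK nth_take // nth_take // nth_drop => /eqP eqg.
(* Sortedness and [eqg] make [g] constant on the [p] entries from position [i] on. *)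
exists (take p (drop i s)), (take i s ++ drop p (drop i s)); split.
- apply: perm_trans perm_s; rewrite -{4}(cat_take_drop i s).
  rewrite -{3}(cat_take_drop p (drop i s)).
  by apply/permP => q; rewrite !count_cat; lia.
- by rewrite size_takel // size_drop; lia.
- apply: zero_sumE; rewrite (eq_big_seq (fun=> g (nth x0 s i))).
    rewrite big_const_seq count_predT iter_addr_0 size_takel ?size_drop; last by lia.
    by rewrite -mulr_natr pchar_Fp_0 // mulr0.
  move=> x /(nthP x0) [j]; rewrite size_takel ?size_drop; last by lia.
  move=> lt_j; rewrite nth_take // nth_drop => <-.
  apply/val_inj/eqP; rewrite eqn_leq; apply/andP; split.
    rewrite [in X in _ <= X]eqg.
    by apply: (sorted_leq_nth leg_tr leg_refl); rewrite ?inE //; lia.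
  by apply: (sorted_leq_nth leg_tr leg_refl); rewrite ?inE //; lia.
Qed.

(** * Erdos-Ginzburg-Ziv for every positive modulus *)

(** Blocks are split off one at a time: while one is still wanted, at least [2 * p - 1] entries
    remain. *)
Lemma zero_sum_subs (T : eqType) (p k : nat) (f : T -> int) (l : seq T) :
  prime p -> p * k.+1 - 1 <= size l ->
  exists (L : seq (seq T)) (t : seq T),
    [/\ perm_eq (flatten L ++ t) l, size L = k,
        all (fun l1 => size l1 == p) L &
        all (fun l1 => (p %| (\sum_(x <- l1) f x)%R)%Z) L].
Proof.
move=> pp; have p0 := prime_gt0 pp; elim: k l => [|k IHk] l sz_l.
  by exists [::], l.
have [|l1 [l2 [pl sz1 dv1]]] := @EGZ_prime T p f l pp.
  by apply: leq_trans sz_l; nia.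
have [|L [t [pL sL aL dL]]] := IHk l2.
  by move: (perm_size pl); rewrite size_cat sz1; nia.
exists (l1 :: L), t; rewrite /= sL sz1 eqxx dv1; split=> //.
by apply: perm_trans pl; rewrite -catA perm_cat2l.
Qed.

(** For [m = q * p], split off [2 * q - 1] zero-sum blocks of size [p]; the case [q], applied to the
    block sums divided by [p], selects [q] of them. The induction varies [T] because its new entries
    are lists. *)
Theorem EGZ (m : nat) (T : eqType) (f : T -> int) (l : seq T) :
  0 < m -> 2 * m - 1 <= size l -> has_zero_sum_sub m f l.
Proof.
elim/ltn_ind: m T f l => m IHm T f l m_gt0 sz_l.
have [m_le1 | m_gt1] := leqP m 1.
  move: sz_l; have -> : m = 1 by lia.
  case: l => [|x l] // _.
  by exists [:: x], l; rewrite dvd1z.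
have [p pp /dvdnP [q defm]] := pdivP m_gt1.
have p_gt1 := prime_gt1 pp.
have q_gt0 : 0 < q by case: q defm => //; lia.
have [|L [t [pL sL aL dL]]] := @zero_sum_subs T p (2 * q - 1) f l pp.
  by apply: leq_trans sz_l; rewrite defm; nia.
have lt_qm : q < m by rewrite defm; nia.
pose F l1 := ((\sum_(x <- l1) f x)%R %/ p)%Z.
have [|L1 [L2 [pL12 sL1 dL1]]] := IHm q lt_qm _ F L q_gt0; first by rewrite sL.
have subL1 : {subset L1 <= L}.
  by move=> x xL1; rewrite -(perm_mem pL12) mem_cat xL1.
exists (flatten L1), (flatten L2 ++ t); split.
- by apply: perm_trans pL; rewrite catA -flatten_cat perm_cat2r perm_flatten.
- rewrite size_flatten /shape sumnE big_map (eq_big_seq (fun=> p)).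
    by rewrite big_const_seq count_predT sL1 iter_addn_0 defm mulnC.
  by move=> l1 /subL1 /(allP aL) /eqP.
- rewrite big_flatten /= (eq_big_seq (fun l1 => F l1 * p)%R).
    by rewrite -mulr_suml defm PoszM dvdz_mul.
  by move=> l1 /subL1 /(allP dL) /divzK ->.
Qed.

Lemma EGZ_fset (m : nat) (Delta : nat -> int) (P : {fset nat}) :
  0 < m -> 2 * m - 1 <= #|` P|%fset ->
  exists S : {fset nat},
    [/\ (S `<=` P)%fset, #|` S|%fset = m & zero_sum_mod m Delta S].
Proof.
move=> m_gt0 /(EGZ Delta m_gt0) [l1 [l2 [pl sz1 dv1]]].
have : uniq (l1 ++ l2) by rewrite (perm_uniq pl) fset_uniq.
rewrite cat_uniq => /and3P [uniq1 _ _].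
exists [fset x in l1]%fset; split.
- by apply/fsubsetP => x; rewrite inE /= => x1; rewrite -(perm_mem pl) mem_cat x1.
- by rewrite card_fseq undup_id.
- rewrite /zero_sum_mod mod0z; apply/dvdz_mod0P.
  rewrite (perm_big l1) //; apply: uniq_perm => // [|x]; first exact: fset_uniq.
  by rewrite inE.
Qed.

(** * Upper bound: zero-sum sets of large diameter *)

Lemma card_nat_itv (a b : nat) : #|` nat_itv a b|%fset = b.+1 - a.
Proof. by rewrite card_fseq undup_id ?iota_uniq // size_iota. Qed.

Lemma fset_neq0 (S : {fset nat}) : 0 < #|` S|%fset -> exists x, x \in S.
Proof. by rewrite cardfs_gt0 => /fset0Pn. Qed.

Definition in_itvE := (in_fsetU, in_fsetI, in_fset1, in_fset0, in_nat_itv).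

(* EGZ is applied to the first [r - 1] points, the midpoint [a + M] and the last
   [r - 1] points of the window: every [r]-subset of these has diameter >= M. *)
Lemma zero_sum_large_diam (r M a : nat) (Delta : nat -> int) :
  1 < r -> r <= M ->
  exists S : {fset nat},
    [/\ (S `<=` nat_itv a (a + 2 * M))%fset, #|` S|%fset = r,
        zero_sum_mod r Delta S & M <= diam S].
Proof.
move=> r_gt1 le_rM.
pose X := nat_itv a (a + r - 2).
pose Y := nat_itv (a + 2 * M - r + 2) (a + 2 * M).
pose P := (X `|` ([fset (a + M)%N] `|` Y))%fset.
have disjP : #|` P|%fset = #|` X|%fset + (1 + #|` Y|%fset).
  rewrite cardfsU (_ : (X `&` _)%fset = fset0) ?cardfs0 ?subn0; last first.
    by apply/fsetP => x; rewrite /P /X /Y !in_itvE; lia.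
  rewrite cardfsU (_ : (_ `&` Y)%fset = fset0) ?cardfs0 ?cardfs1 ?subn0 //.
  by apply/fsetP => x; rewrite /P /X /Y !in_itvE; lia.
have [||S [sSP cS zS]] := @EGZ_fset r Delta P; first by lia.
  by rewrite disjP !card_nat_itv; lia.
exists S; split=> //.
  apply: fsubset_trans sSP _; apply/fsubsetP => x.
  by rewrite /P /X /Y !in_itvE; lia.
rewrite leqNgt; apply/negP => ltD.
have [x0 x0S] : exists x, x \in S by apply: fset_neq0; lia.
have minS := fset_min_in x0S.
pose u := fset_min S.
have inS x : x \in S -> (x \in P) && (u <= x < u + M).
  move=> xS; rewrite (fsubsetP sSP) // fset_min_le //=.
  by have := fset_max_ge xS; move: ltD; rewrite /diam -/u; lia.
have uP : u \in P by case/andP: (inS _ minS).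
(* [S] lies among the [M] consecutive integers from [u]; the points of [P] there are covered by
   fewer than [r] points, according to the position of [u]. *)
suff [Q sSQ ltQ] : exists2 Q : {fset nat}, (S `<=` Q)%fset & #|` Q|%fset < r.
  by have := fsubset_leq_card sSQ; lia.
have [u0 | u0] := eqVneq u a.
  exists X; last by rewrite card_nat_itv; lia.
  apply/fsubsetP => x /inS; rewrite /P /X /Y !in_itvE; lia.
have [uX | uX] := leqP u (a + r - 2).
  (* Compared with [u = a], the window loses [u - a] points of [X] and gains at most the midpoint
     and [u - a - 1] points of [Y]. *)
  exists (nat_itv u (a + r - 2) `|` ([fset (a + M)%N] `|`
    nat_itv (a + 2 * M - r + 2) (u + M - 1)))%fset.
    apply/fsubsetP => x /inS; rewrite /P /X /Y !in_itvE; lia.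
  apply: leq_ltn_trans (_ : _ <= #|` nat_itv u (a + r - 2)|%fset +
    (1 + #|` nat_itv (a + 2 * M - r + 2) (u + M - 1)|%fset)) _.
    by rewrite !cardfsU cardfs1; lia.
  rewrite !card_nat_itv; move: uP; rewrite /P /X /Y !in_itvE; lia.
have [uM | uM] := eqVneq u (a + M).
  exists ([fset (a + M)%N] `|` nat_itv (a + 2 * M - r + 2) (a + 2 * M - 1))%fset.
    apply/fsubsetP => x /inS; rewrite /P /X /Y !in_itvE; lia.
  by rewrite cardfsU cardfs1 card_nat_itv; lia.
exists Y; last by rewrite card_nat_itv; lia.
apply/fsubsetP => x /inS; move: uP; rewrite /P /X /Y !in_itvE; lia.
Qed.

Lemma forces_pair_upper (r s : nat) :
  1 < s -> 1 < r -> r <= 2 * s - 2 -> forces_pair s r (6 * s - 4).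
Proof.
move=> s_gt1 r_gt1 le_r Delta.
have [||S1 [sub1 c1 z1]] := @EGZ_fset s Delta (nat_itv 1 (2 * s - 1)).
- by lia.
- by rewrite card_nat_itv; lia.
(* Here [M = 2 * s - 2], so the window ends at [6 * s - 4]. *)
have [S2 [sub2 c2 z2 d2]] := @zero_sum_large_diam r _ (2 * s) Delta r_gt1 le_r.
have [x1 x1S] : exists x, x \in S1 by apply: fset_neq0; lia.
have [x2 x2S] : exists x, x \in S2 by apply: fset_neq0; lia.
have in1 x : x \in S1 -> 1 <= x <= 2 * s - 1.
  by move/(fsubsetP sub1); rewrite in_nat_itv.
have in2 x : x \in S2 -> 2 * s <= x <= 6 * s - 4.
  by move/(fsubsetP sub2); rewrite in_nat_itv; lia.
have := in1 _ (fset_min_in x1S); have := in1 _ (fset_max_in x1S).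
have := in2 _ (fset_min_in x2S).
exists S1, S2; split=> //; last 2 first.
- by lia.
- by apply: leq_trans d2; rewrite /diam; lia.
by split; apply/fsubsetP => x; [move/in1 | move/in2]; rewrite in_nat_itv; lia.
Qed.

(** * Lower bound: a coloring without a suitable pair *)

(** The number of points of color 1 is a multiple of [m] and at most [m], so it is 0 or [m]. *)
Lemma zero_sum_bool_constant (m : nat) (D : nat -> nat) (c : nat -> bool)
    (S : {fset nat}) :
  (forall x, D x = c x %[mod m]) -> #|` S|%fset = m ->
  zero_sum_mod m (fun x => Posz (D x)) S ->
  {in S &, forall x y, c x = c y}.
Proof.
move=> Dc cS; rewrite /zero_sum_mod -[LHS]/(modz _ _).
have -> : (\sum_(y <- S) Posz (D y))%R = Posz (\sum_(y <- S) D y)%N.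
  by rewrite (big_morph Posz PoszD (erefl _)).
rewrite mod0z modz_nat => -[].
rewrite -modn_summ (eq_bigr _ (fun i _ => Dc i)) modn_summ.
rewrite (_ : \sum_(y <- S) _ = count c S); last first.
  by rewrite -sumn_count sumnE big_map.
move/eqP => dvd_m x y xS yS.
have [c0 | c_gt0] := posnP (count c S).
  have noc z : z \in S -> c z = false.
    move=> zS; apply/negbTE/negP => cz.
    by have : has c S; [apply/hasP; exists z | rewrite has_count c0].
  by rewrite !noc.
have : all c S.
  rewrite all_count eqn_leq count_size /=.
  by rewrite (_ : size S = m) // dvdn_leq.
by move/allP => allc; rewrite !allc.
Qed.

(* Two points of [S] congruent mod [d] at distance less than [2d] would lie in
   adjacent blocks, of opposite colors; so [x |-> x %% d] is injective on [S]. *)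
Lemma alternating_blocks_diam (d : nat) (S : {fset nat}) :
  0 < d -> d < #|` S|%fset ->
  {in S &, forall x y, odd (x %/ d) = odd (y %/ d)} -> 2 * d <= diam S.
Proof.
move=> d_gt0 ltS oddS; rewrite leqNgt; apply/negP => ltD.
have injS : {in S &, injective (modn^~ d)}.
  suff H x y : x \in S -> y \in S -> x %% d = y %% d -> x <= y -> x = y.
    move=> x y xS yS /= exy.
    by have [le_xy | /ltnW le_yx] := leqP x y; [apply: H | apply/esym/H].
  move=> xS yS exy le_xy.
  have := oddS _ _ xS yS; have := fset_max_ge yS; have := fset_min_le xS.
  have := divn_eq y d; have := divn_eq x d; rewrite exy; move: ltD; rewrite /diam.
  move: (x %/ d) (y %/ d) (y %% d) => qx qy t ltD def_x def_y ge_min le_max odd_q.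
  suff eq_q : qx = qy by rewrite def_x def_y eq_q.
  have le_q : qx <= qy by rewrite -(leq_pmul2r d_gt0); lia.
  have lt_q : qy < qx + 2 by rewrite -(ltn_pmul2r d_gt0) mulnDl; lia.
  have [//|ne_q] := eqVneq qx qy.
  have eq_q : qy = qx.+1 by lia.
  by move: odd_q; rewrite eq_q /=; case: odd.
have := @uniq_leq_size _ (map (modn^~ d) S) (iota 0 d).
rewrite map_inj_in_uniq // fset_uniq size_map size_iota => /(_ isT).
move=> H; have : size S <= d; last by rewrite leqNgt ltS.
by apply: H => _ /mapP [x _ ->]; rewrite mem_iota ltn_pmod.
Qed.

Lemma forces_pair_lower (r s k : nat) :
  2 <= s -> 0 < r -> coprime s r -> forces_pair s r k -> 6 * s - 4 <= k.
Proof.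
move=> s_gt1 r_gt0 co; rewrite leqNgt => fk; apply/negP => lt_k; move: fk.
pose c1 x := odd (x %/ s.-1); pose c2 x := 4 * s - 3 < x.
pose D x := chinese s r (c1 x) (c2 x).
case/(_ (fun x => Posz (D x))) => S1 [S2 [[sub1 sub2] [z1 z2] [n1 n2] lt12 d12]].
have [x1 x1S] : exists x, x \in S1 by apply: fset_neq0; lia.
have [x2 x2S] : exists x, x \in S2 by apply: fset_neq0; lia.
have const1 := zero_sum_bool_constant (fun x => chinese_modl co _ _) n1 z1.
have const2 := zero_sum_bool_constant (fun x => chinese_modr co _ _) n2 z2.
have d1 : 2 * s.-1 <= diam S1 by apply: alternating_blocks_diam => //; lia.
(* [S1] ends at [2 * s - 1] or later, so [S2] starts at [2 * s] or later; its extremes are on the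
   same side of the cut after [4 * s - 3]. *)
have := const2 _ _ (fset_min_in x2S) (fset_max_in x2S).
have := fsubsetP sub2 _ (fset_max_in x2S).
have := fsubsetP sub1 _ (fset_min_in x1S).
rewrite !in_nat_itv; move: d1 d12; rewrite /diam /c2; lia.
Qed.

Theorem theorem3p3 (r s : nat) (hs : 3 <= s) (hsr : s <= r)
    (hgcd : gcdn r s = 1) (hr : r <= 2 * s - 2) :
  fZ s r = 6 * s - 4.
Proof.
have upper : forces_pair s r (6 * s - 4) by apply: forces_pair_upper; lia.
have lower k : forces_pair s r k -> 6 * s - 4 <= k.
  by apply: forces_pair_lower; rewrite /coprime 1?gcdnC ?hgcd //; lia.
(* The minimum exists and is unique, so [xget] returns it and not the default 0. *)
apply: classical_sets.xget_unique; first by split=> //; [lia | move=> k _ /lower].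
move=> n [n_gt0 /lower le_n min_n].
by apply/eqP; rewrite eqn_leq le_n min_n //; lia.
Qed.
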